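(* Let $A\subseteq\mathbb{R}$ be a nonempty compact set and let $\mathcal L_A=(\ell_j)_j$ be the associated fractal string. Then the tube function $\varepsilon\mapsto V_A(\varepsilon):=V(A_\varepsilon\setminus A)$ is piecewise linear (and thus piecewise differentiable) on $(0,\infty)$ and, for each $\varepsilon\in(0,\infty)\setminus\{\ell_j/2:j\}$, $$V_A'(\varepsilon)=2\beta_0(A;\varepsilon)=2+2N_{\mathcal L_A}\!\left(\tfrac1{2\varepsilon}\right).$$ Moreover, right and left derivatives of $V_A$ exist for all $\varepsilon>0$ and satisfy $$V_A^{(+)}(\varepsilon)=2\beta_0(A;\varepsilon)\quad\text{and}\quad V_A^{(-)}(\varepsilon)=2+2N_{\mathcal L_A}\!\left(\tfrac1{2\varepsilon}\right),$$ respectively. Furthermore, if $\tilde{\mathcal L}_A=(\tilde\ell_m)_m$ denotes the strictly decreasing sequence of all distinct finite lengths of the disjoint open intervals that comprise the complement of $A$, and $w_m$ is the multiplicity of $\tilde\ell_m$ in $\mathcal L_A$, then, for each $m$ and each $\varepsilon\in(\tilde\ell_{m+1}/2,\tilde\ell_m/2)$, $$V_A'(\varepsilon)=2+2\sum_{k=1}^m w_k .$$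
   Context: $V$ is Lebesgue measure on $\mathbb{R}$ and $A_\varepsilon=\{x\in\mathbb{R}:\mathrm{dist}(x,A)\le\varepsilon\}$. The fractal string $\mathcal L_A=(\ell_j)$ of a nonempty compact $A\subset\mathbb{R}$ is the (finite or infinite) non-increasing sequence of lengths of the bounded connected components (open intervals) of $\mathbb{R}\setminus A$, each length repeated according to the number of such intervals having that length (its multiplicity). Its geometric counting function is $N_{\mathcal L_A}(x)=\#\{j:\ell_j^{-1}\le x\}$, $x>0$. ''Piecewise linear'' means affine on each of the open intervals into which $(0,\infty)$ is divided by the points $\ell_j/2$ (which may accumulate only at $0$). Let $\partial^+A$ be the set of endpoints of the connected components of $\mathbb{R}\setminus A$, and $N(A)=\{(x,n):x\in\partial^+A,\ n\in\{+1,-1\},\ x+n s\notin A \text{ for all } s\in(0,\eta]\text{ for some }\eta>0\}$. The local reach at $(x,n)\in N(A)$ is $\delta(A,x,n)=\sup\{t\ge0: x\text{ is the unique nearest point of }A\text{ to }x+tn\}\in(0,\infty]$. The support measure $\mu_0(A;\cdot)$ is $\tfrac12$ times the counting measure on $N(A)$, and the basic function of $A$ is $\beta_0(A;t)=\int_{N(A)}\mathbf 1\{t<\delta(A,x,n)\}\,\mu_0(A;d(x,n))=\tfrac12\#\{(x,n)\in N(A):\delta(A,x,n)>t\}$, $t>0$. *)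

(* Defs.v *)
From HB Require Import structures.
From mathcomp Require Import all_boot all_order all_algebra.
From mathcomp Require Import all_classical all_reals all_analysis.

Set Implicit Arguments.
Unset Strict Implicit.
Unset Printing Implicit Defensive.

Import Order.TTheory GRing.Theory Num.Theory.
Import numFieldNormedType.Exports.

Local Open Scope classical_set_scope.
Local Open Scope ring_scope.

Section Tube.
Context {R : realType}.
Implicit Types (A C : set R) (x n t eps : R).

Definition dist_to A x : R := inf [set `|x - a| | a in A].

Definition parallel_set A eps : set R := [set x | dist_to A x <= eps].

(* [fine] is harmless for bounded [A]: the measured set has finite measure. *)
Definition tube_function A eps : R :=
  fine (lebesgue_measure (parallel_set A eps `\` A)).

Definition complement_components A : set (set R) :=
  [set connected_component (~` A) x | x in ~` A].

Definition gaps A : set (set R) :=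
  [set C | complement_components A C /\ bounded_set C].

Definition gap_length C : R := sup C - inf C.

(* A finite or infinite sequence of positive reals is encoded, starting at
   index 0, as a function [nat -> R], a finite sequence being continued by
   zeros; [terms l] is the set of indices of its actual terms. *)
Definition terms (l : nat -> R) : set nat := [set j | 0 < l j].

Definition is_fractal_string A (l : nat -> R) : Prop :=
  [/\ forall j, 0 <= l j,
      forall i j, (i <= j)%N -> l j <= l i &
      exists2 g : nat -> set R,
        set_bij (terms l) (gaps A) g &
        forall j, terms l j -> l j = gap_length (g j)].

(* The restriction to [terms l] matters, since [0^-1 = 0] in MathComp. *)
Definition geometric_counting (l : nat -> R) x : \bar R :=
  counting [set j | terms l j /\ (l j)^-1 <= x].

Definition half_lengths (l : nat -> R) : set R :=
  [set l j / 2 | j in terms l].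

Definition is_distinct_lengths A (l : nat -> R) : Prop :=
  [/\ forall m, 0 <= l m,
      forall i j, (i <= j)%N -> l j <= l i,
      forall i j, (i < j)%N -> terms l j -> l j < l i &
      [set l m | m in terms l] = [set gap_length C | C in gaps A]].

Definition multiplicity (l : nat -> R) x : \bar R :=
  counting [set j | terms l j /\ l j = x].

Definition is_endpoint C x : Prop :=
  (has_lbound C /\ x = inf C) \/ (has_ubound C /\ x = sup C).

Definition outer_boundary A : set R :=
  [set x | exists2 C, complement_components A C & is_endpoint C x].

Definition normal_bundle A : set (R * R) :=
  [set p | [/\ outer_boundary A p.1,
               p.2 = 1 \/ p.2 = -1 &
               exists2 eta, 0 < eta &
                 forall s, 0 < s <= eta -> ~ A (p.1 + p.2 * s)]].

Definition unique_nearest A y x : Prop :=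
  A x /\ forall a, A a -> a != x -> `|y - x| < `|y - a|.

Definition local_reach A (p : R * R) : \bar R :=
  ereal_sup [set t%:E | t in
    [set t : R | 0 <= t /\ unique_nearest A (p.1 + t * p.2) p.1]].

(* The support measure [mu_0] of [A] is the restriction of this measure to
   [normal_bundle A]; below it is only integrated over that set. *)
Definition half_counting : {measure set (R * R) -> \bar R} :=
  mscale (2^-1)%:nng (@counting (R * R)%type R).

Definition basic_function A t : \bar R :=
  \int[half_counting]_(p in normal_bundle A)
    (\1_[set p | (t%:E < local_reach A p)%E] p)%:E.

Definition piecewise_linear_pos (S : set R) (f : R -> R) : Prop :=
  (forall d : R, 0 < d -> finite_set (S `&` `[d, +oo[)) /\
  (forall x, (`]0, +oo[ `\` S) x ->
    exists a b : R,
      forall y, connected_component (`]0, +oo[ `\` S) x y -> f y = a * y + b).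

Definition difference_quotient (f : R -> R) x (h : R) : R :=
  h^-1 * (f (x + h) - f x).

Definition right_derivable (f : R -> R) x : Prop :=
  cvg (difference_quotient f x h @[h --> 0^'+]).
Definition right_derivative (f : R -> R) x : R :=
  lim (difference_quotient f x h @[h --> 0^'+]).

Definition left_derivable (f : R -> R) x : Prop :=
  cvg (difference_quotient f x h @[h --> 0^'-]).
Definition left_derivative (f : R -> R) x : R :=
  lim (difference_quotient f x h @[h --> 0^'-]).

End Tube.

(* Main.v *)
(** For 0 < x <= y the set of points whose distance to A lies in ]x, y] is covered
    by the closed segments of length y - x issued at height x from the normals
    (a, n) of A with local reach > x, and contains the corresponding open segments.
    If no gap length lies in ]2x, 2y[, all these reaches are at least y, so points
    of the open segments have a unique nearest point and the open segments are
    disjoint.  Hence V_A(y) - V_A(x) = (y - x) #{reach > x}.  The normals of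
    reach > x are the two outer ones and two for each of the finitely many gaps of
    length > 2x, so V_A is affine between consecutive half lengths, with slope
    2 + 2 #{j : l_j > 2x} to the right of x and 2 + 2 #{j : l_j >= 2x} to its left. *)
Require Import Defs.
From mathcomp Require Import all_boot all_order all_algebra.
From mathcomp Require Import all_classical all_reals all_analysis.
From mathcomp Require Import ring lra.
Set Implicit Arguments.
Unset Strict Implicit.
Unset Printing Implicit Defensive.

Import Order.TTheory GRing.Theory Num.Theory.
Import numFieldNormedType.Exports.
Local Open Scope classical_set_scope.
Local Open Scope ring_scope.

(** * Complementary components of a compact set, and its normal bundle *)

Section Ends.
Context {R : realType}.
Implicit Types (A C : set R) (x y z p q a : R).

(** A bounded component recorded by its two endpoints, as [gapsP] confirms. This turns questions
    about connected components into order statements that [lra] can settle. *)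
Definition gap_ends A p q :=
  [/\ A p, A q, p < q & forall z, p < z < q -> ~ A z].
Definition is_max_of A p := A p /\ forall a, A a -> a <= p.
Definition is_min_of A p := A p /\ forall a, A a -> p <= a.

Lemma compact_is_min A : A !=set0 -> compact A -> exists p, is_min_of A p.
Proof.
move=> A0 cA; have [|p /set_mem Ap pA] :=
  @compact_EVT_min _ R id A A0 cA; first by apply: continuous_subspaceT => x; exact: cvg_id.
by exists p; split=> // a /mem_set; exact: pA.
Qed.

Lemma compact_is_max A : A !=set0 -> compact A -> exists p, is_max_of A p.
Proof.
move=> A0 cA; have [|p /set_mem Ap pA] :=
  @compact_EVT_max _ R id A A0 cA; first by apply: continuous_subspaceT => x; exact: cvg_id.
by exists p; split=> // a /mem_set; exact: pA.
Qed.

Lemma compact_last_below A z a : compact A -> A a -> a <= z ->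
  exists p, is_max_of (A `&` [set x | x <= z]) p.
Proof.
move=> cA Aa az; apply: compact_is_max; first by exists a.
exact: compact_closedI cA (@closed_le _ z).
Qed.

Lemma compact_first_above A z a : compact A -> A a -> z <= a ->
  exists p, is_min_of (A `&` [set x | z <= x]) p.
Proof.
move=> cA Aa az; apply: compact_is_min; first by exists a.
exact: compact_closedI cA (@closed_ge _ z).
Qed.

(** Take for [p] the last point of [A] below [z] and for [q] the first one above. A point of [A]
    strictly between them would contradict the extremality of one of the two. *)
Lemma gap_ends_around A z : compact A -> ~ A z ->
  (exists2 a, A a & a <= z) -> (exists2 a, A a & z <= a) ->
  exists p q, gap_ends A p q /\ p < z < q.
Proof.
move=> cA Az [a Aa az] [b Ab zb].
have [p [[Ap /= pz] pmax]] := compact_last_below cA Aa az.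
have [q [[Aq /= zq] qmin]] := compact_first_above cA Ab zb.
have {}pz : p < z.
  by rewrite lt_neqAle pz andbT; apply/eqP => pz'; apply: Az; rewrite -pz'.
have {}zq : z < q.
  by rewrite lt_neqAle zq andbT; apply/eqP => zq'; apply: Az; rewrite zq'.
exists p, q; split; last by rewrite pz.
split=> //; first exact: lt_trans zq.
move=> y /andP[py yq] Ay; have [yz|zy] := leP y z.
  by have := pmax y (conj Ay yz); lra.
by have := qmin y (conj Ay (ltW zy)); lra.
Qed.

(* The last hypothesis says that [A] separates [z] from every point outside [I]. *)
Lemma connected_component_is_interval A (I : set R) z :
  is_interval I -> I z -> I `<=` ~` A ->
  (forall y, ~ I y -> exists2 a, A a & (z <= a <= y) || (y <= a <= z)) ->
  connected_component (~` A) z = I.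
Proof.
move=> itvI Iz IA sep; apply/seteqP; split; last first.
  by apply: connected_component_max => //; exact/connected_intervalP.
move=> y Cy; apply: contrapT => Iy; have [a Aa ay] := sep y Iy.
have zC : connected_component (~` A) z z.
  by apply: connected_component_refl; exact: IA.
have itvC : is_interval (connected_component (~` A) z).
  exact/connected_intervalP/component_connected.
suff: connected_component (~` A) z a by move/connected_component_sub; exact.
by case/orP: ay => ay; [exact: itvC zC Cy _ ay|exact: itvC Cy zC _ ay].
Qed.

Lemma component_of_gap_ends A p q z : gap_ends A p q -> p < z < q ->
  connected_component (~` A) z = `]p, q[%classic.
Proof.
move=> [Ap Aq pq pqA] /andP[pz zq].
apply: connected_component_is_interval.
- exact: interval_is_interval.
- by rewrite /= in_itv /= pz zq.
- by move=> y /=; rewrite in_itv /= => /pqA.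
- move=> y /=; rewrite in_itv /= => /negP; rewrite negb_and -!leNgt.
  move=> /orP[yp|qy]; first by exists p => //; lra.
  by exists q => //; lra.
Qed.

Lemma component_below_min A p z : is_min_of A p -> z < p ->
  connected_component (~` A) z = `]-oo, p[%classic.
Proof.
move=> [Ap pA] zp; apply: connected_component_is_interval.
- exact: interval_is_interval.
- by rewrite /= in_itv.
- by move=> y /=; rewrite in_itv /= => yp /pA; lra.
- by move=> y /=; rewrite in_itv /= => /negP; rewrite -leNgt; exists p => //; lra.
Qed.

Lemma component_above_max A p z : is_max_of A p -> p < z ->
  connected_component (~` A) z = `]p, +oo[%classic.
Proof.
move=> [Ap pA] zp; apply: connected_component_is_interval.
- exact: interval_is_interval.
- by rewrite /= in_itv /= zp.
- by move=> y /=; rewrite in_itv /= andbT => yp /pA; lra.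
- move=> y /=; rewrite in_itv /= andbT => /negP; rewrite -leNgt.
  by exists p => //; lra.
Qed.

(** A point off [A] lies below the minimum, above the maximum, or between two points of [A] and
    hence in a gap. Conversely a midpoint, or a point one unit beyond the extremum, represents the
    component. *)
Lemma complement_componentsP A C : A !=set0 -> compact A ->
  complement_components A C <->
  [\/ exists p q, gap_ends A p q /\ C = `]p, q[%classic,
      exists2 p, is_min_of A p & C = `]-oo, p[%classic |
      exists2 p, is_max_of A p & C = `]p, +oo[%classic].
Proof.
move=> A0 cA; split=> [[z /= Az <-]|].
  have [p minp] := compact_is_min A0 cA; have [q maxq] := compact_is_max A0 cA.
  have [zp|pz] := ltP z p.
    by apply: Or32; exists p => //; exact: component_below_min.
  have [qz|zq] := ltP q z.
    by apply: Or33; exists q => //; exact: component_above_max.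
  have [||p' [q' [pq' zpq]]] := gap_ends_around cA Az.
  - by exists p => //; case: minp.
  - by exists q => //; case: maxq.
  - by apply: Or31; exists p', q'; split=> //; exact: component_of_gap_ends.
case=> [[p [q [pq ->]]]|[p minp ->]|[p maxp ->]].
- case: (pq) => _ _ ltpq pqA; have zpq : p < (p + q) / 2 < q by lra.
  by exists ((p + q) / 2); [exact: pqA|exact: component_of_gap_ends].
- exists (p - 1); last by apply: component_below_min => //; lra.
  by move=> /= /(proj2 minp); lra.
- exists (p + 1); last by apply: component_above_max => //; lra.
  by move=> /= /(proj2 maxp); lra.
Qed.

Lemma bounded_set_le C : bounded_set C -> exists M, forall x, C x -> `|x| <= M.
Proof.
by move=> [M [_ /(_ (M + 1))]]; rewrite ltrDl ltr01 => /(_ isT) CM; exists (M + 1).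
Qed.

Lemma gapsP A C : A !=set0 -> compact A ->
  gaps A C <-> exists p q, gap_ends A p q /\ C = `]p, q[%classic.
Proof.
move=> A0 cA; split.
  case=> /(complement_componentsP _ A0 cA)[//|[p _ ->]|[p _ ->]] /bounded_set_le[M bM].
  (* This point of the half-line has absolute value above [M], so the half-line is unbounded; the
     other half-line is treated symmetrically. *)
  - have := bM (Num.min (p - 1) (- M - 1)).
    rewrite /= in_itv /= gt_min [p - 1 < p]ltrBlDr ltrDl ltr01 => /(_ isT).
    rewrite ler_norml => /andP[+ _]; rewrite le_min => /andP[_]; lra.
  - have := bM (Num.max (p + 1) (M + 1)).
    rewrite /= in_itv /= andbT lt_max ltrDl ltr01 => /(_ isT).
    rewrite ler_norml => /andP[_]; rewrite ge_max => /andP[_]; lra.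
move=> [p [q [pq ->]]]; split.
  by apply/complement_componentsP => //; apply: Or31; exists p, q.
exists (`|p| + `|q|); split; first exact: num_real.
move=> M pqM x /=; rewrite in_itv /= => /andP[px xq]; apply: le_trans (ltW pqM).
rewrite ler_norml; apply/andP; split.
  by have := ler_norm (- p); rewrite normrN; have := normr_ge0 q; lra.
by have := ler_norm q; have := normr_ge0 p; lra.
Qed.

Lemma gap_ends_inf_sup A p q : gap_ends A p q ->
  inf (`]p, q[%classic) = p /\ sup (`]p, q[%classic) = q.
Proof. by move=> [_ _ pq _]; rewrite inf_itv ?sup_itv. Qed.

(** If the right ends differed, the smaller one would be a point of [A] inside the other gap. *)
Lemma gap_ends_injl A p q q' : gap_ends A p q -> gap_ends A p q' -> q = q'.
Proof.
move=> [Ap Aq pq pqA] [_ Aq' pq' pqA']; apply/eqP; rewrite eq_le !leNgt.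
by apply/andP; split; apply/negP => qq; [case: (pqA q')|case: (pqA' q)] => //;
  apply/andP.
Qed.

Lemma gap_ends_injr A p p' q : gap_ends A p q -> gap_ends A p' q -> p = p'.
Proof.
move=> [Ap Aq pq pqA] [Ap' _ pq' pqA']; apply/eqP; rewrite eq_le !leNgt.
by apply/andP; split; apply/negP => qq; [case: (pqA' p)|case: (pqA p')] => //;
  apply/andP.
Qed.

(** The enumeration of gaps as sets is traded for two real functions giving their ends. Both inherit
    injectivity from [g], because a gap is determined by either of its ends. *)
Lemma fractal_string_ends A l : A !=set0 -> compact A -> is_fractal_string A l ->
  exists lo hi : nat -> R,
  [/\ forall j, terms l j -> gap_ends A (lo j) (hi j),
      forall j, terms l j -> l j = hi j - lo j,
      forall p q, gap_ends A p q ->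
        exists j, [/\ terms l j, lo j = p & hi j = q],
      {in terms l &, injective lo} & {in terms l &, injective hi}].
Proof.
move=> A0 cA [_ _ [g /[dup] /set_bij_homo gH /[dup] /set_bij_inj gI gS lg]].
exists (fun j => inf (g j)), (fun j => sup (g j)).
have gE j : terms l j ->
    gap_ends A (inf (g j)) (sup (g j)) /\ g j = `]inf (g j), sup (g j)[%classic.
  move=> /gH /(gapsP _ A0 cA)[p [q [pq ->]]].
  by have [-> ->] := gap_ends_inf_sup pq.
split=> [j /gE[]//|j /lg//|p q pq|i j ti tj e|i j ti tj e].
- have /(set_bij_surj gS)[j tj gj] : gaps A `]p, q[%classic.
    by apply/(gapsP _ A0 cA); exists p, q.
  by exists j; rewrite gj; have [-> ->] := gap_ends_inf_sup pq.
- apply: gI => //; move: ti tj => /set_mem/gE[ei ->] /set_mem/gE[ej ->].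
  by rewrite -e in ej *; rewrite (gap_ends_injl ei ej).
- apply: gI => //; move: ti tj => /set_mem/gE[ei ->] /set_mem/gE[ej ->].
  by rewrite -e in ej *; rewrite (gap_ends_injr ei ej).
Qed.

(** The bounds required by [is_endpoint] discard the meaningless [inf] or [sup] on the unbounded
    side of a half-line; what remains is an end that lies in [A]. *)
Lemma endpoint_mem A C x : A !=set0 -> compact A ->
  complement_components A C -> is_endpoint C x -> A x.
Proof.
move=> A0 cA /(complement_componentsP _ A0 cA)[[p [q [pq ->]]]|[p [Ap _] ->]|[p [Ap _] ->]].
- have [ei es] := gap_ends_inf_sup pq; case: pq => Ap Aq _ _.
  by case=> -[_ ->]; rewrite ?ei ?es.
- case=> -[b ->]; last by rewrite sup_itv.
  case: b => M /(_ (Num.min (p - 1) (M - 1))).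
  rewrite /= in_itv /= gt_min [p - 1 < p]ltrBlDr ltrDl ltr01 => /(_ isT).
  by rewrite le_min => /andP[_]; lra.
- case=> -[b ->]; first by rewrite inf_itv.
  case: b => M /(_ (Num.max (p + 1) (M + 1))).
  rewrite /= in_itv /= andbT lt_max ltrDl ltr01 => /(_ isT).
  by rewrite ge_max => /andP[_]; lra.
Qed.

(** If [x] is not the maximum, a short step to the right reaches a point [z] off [A]. The gap around
    [z] must start at [x]: its left end belongs to [A], while the points between [x] and [z] do
    not. *)
Lemma normal_bundle_right A x : A !=set0 -> compact A ->
  normal_bundle A (x, 1) <->
  A x /\ (is_max_of A x \/ exists q, gap_ends A x q).
Proof.
move=> A0 cA; split=> [[[C CA /(endpoint_mem A0 cA CA) /= Ax] _ [eta eta0 /= etaA]]|].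
  split=> //; have [q maxq] := compact_is_max A0 cA.
  have [xq|qx] := ltP x q; last first.
    by left; split=> // a /(proj2 maxq) aq; exact: le_trans aq qx.
  (* The cap [q - x] keeps [z] at or below the maximum [q], so that [z] is enclosed by points of
     [A]. *)
  right; pose z := x + Num.min eta (q - x).
  have zA : 0 < Num.min eta (q - x) <= eta.
    by rewrite lt_min eta0 subr_gt0 xq ge_min lexx.
  have Az : ~ A z by have := etaA _ zA; rewrite mul1r.
  have [||p [q' [pq /andP[pz zq]]]] := gap_ends_around cA Az.
  - by exists x => //; rewrite /z; lra.
  - exists q; first by case: maxq.
    have : Num.min eta (q - x) <= q - x by rewrite ge_min lexx orbT.
    by rewrite /z; lra.
  - exists q'; suff -> : x = p by [].
    case: (pq) => Ap _ _ pqA; apply/eqP; rewrite eq_le !leNgt.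
    apply/andP; split; apply/negP => px; first by apply: (pqA x) => //; rewrite /z in zq; lra.
    by apply: (etaA (p - x)); [rewrite /z in pz; lra|rewrite mul1r addrC subrK].
move=> [Ax [maxx|[q xq]]].
- split; [|by left|exists 1 => //= s /andP[s0 _] /(proj2 maxx)]; last lra.
  exists `]x, +oo[%classic; first by apply/complement_componentsP => //; apply: Or33; exists x.
  left; split; last by rewrite inf_itv.
  by exists x => y /=; rewrite in_itv /= andbT => /ltW.
- split; [|by left|].
  + exists `]x, q[%classic.
      by apply/complement_componentsP => //; apply: Or31; exists x, q.
    left; split; last by have [->] := gap_ends_inf_sup xq.
    by exists x => y /=; rewrite in_itv /= => /andP[/ltW].
  + case: xq => _ _ ltxq xqA; exists ((q - x) / 2); first lra.
    by move=> s /= ?; apply: xqA; lra.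
Qed.

Lemma normal_bundle_left A x : A !=set0 -> compact A ->
  normal_bundle A (x, -1) <->
  A x /\ (is_min_of A x \/ exists p, gap_ends A p x).
Proof.
move=> A0 cA; split=> [[[C CA /(endpoint_mem A0 cA CA) /= Ax] _ [eta eta0 /= etaA]]|].
  split=> //; have [p minp] := compact_is_min A0 cA.
  have [px|xp] := ltP p x; last first.
    by left; split=> // a /(proj2 minp) aq; exact: le_trans xp aq.
  right; pose z := x - Num.min eta (x - p).
  have zA : 0 < Num.min eta (x - p) <= eta.
    by rewrite lt_min eta0 subr_gt0 px ge_min lexx.
  have Az : ~ A z by have := etaA _ zA; rewrite mulN1r.
  have [||p' [q' [pq /andP[pz zq]]]] := gap_ends_around cA Az.
  - exists p; first by case: minp.
    have : Num.min eta (x - p) <= x - p by rewrite ge_min lexx orbT.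
    by rewrite /z; lra.
  - by exists x => //; rewrite /z; lra.
  - exists p'; suff -> : x = q' by [].
    case: (pq) => _ Aq _ pqA; apply/eqP; rewrite eq_le !leNgt.
    apply/andP; split; apply/negP => xq; last first.
      by apply: (pqA x) => //; rewrite /z in pz; lra.
    by apply: (etaA (x - q')); [rewrite /z in zq; lra|rewrite mulN1r opprB addrC subrK].
move=> [Ax [minx|[p px]]].
- split; [|by right|exists 1 => //= s /andP[s0 _] /(proj2 minx)]; last lra.
  exists `]-oo, x[%classic; first by apply/complement_componentsP => //; apply: Or32; exists x.
  right; split; last by rewrite sup_itv.
  by exists x => y /=; rewrite in_itv /= => /ltW.
- split; [|by right|].
  + exists `]p, x[%classic.
      by apply/complement_componentsP => //; apply: Or31; exists p, x.
    right; split; last by have [_ ->] := gap_ends_inf_sup px.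
    by exists x => y /=; rewrite in_itv /= => /andP[_ /ltW].
  + case: px => _ _ ltxq xqA; exists ((x - p) / 2); first lra.
    by move=> s /= ?; apply: xqA; lra.
Qed.

End Ends.

(** * Local reach along a normal, and enumeration of the normals of large reach *)

Section Reach.
Context {R : realType}.
Implicit Types (A C : set R) (x y z p q a t : R) (l : nat -> R).

(** Moving the observer from height [t] down to [s] brings it closer to [x] by exactly [t - s], and
    closer to any other point by at most that much. *)
Lemma unique_nearest_closer A x n s t : `|n| = 1 -> 0 <= s <= t ->
  unique_nearest A (x + t * n) x -> unique_nearest A (x + s * n) x.
Proof.
move=> n1 /andP[s0 st] [Ax xA]; split=> // a Aa ax.
have xE r : 0 <= r -> `|x + r * n - x| = r.
  by move=> r0; rewrite addrC addKr normrM n1 mulr1 ger0_norm.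
rewrite xE //; have := xA a Aa ax; rewrite xE; last exact: le_trans st.
have : `|x + t * n - a| <= `|x + s * n - a| + (t - s).
  rewrite (_ : x + t * n - a = x + s * n - a + (t - s) * n); last by ring.
  apply: le_trans (ler_normD _ _) _.
  by rewrite normrM n1 mulr1 (ger0_norm (_ : 0 <= t - s)) // subr_ge0.
lra.
Qed.

Lemma lt_local_reachP A x n t :
  (t%:E < local_reach A (x, n))%E <->
  exists s, [/\ t < s, 0 <= s & unique_nearest A (x + s * n) x].
Proof.
split=> [/ereal_sup_gt[_ [s [s0 xs] <-]] ts|[s [ts s0 xs]]]; first by exists s.
by apply: lt_le_trans (ereal_sup_ubound _); [|exists s => //]; rewrite lte_fin.
Qed.

Lemma unique_nearest_lt_reach A x n t : `|n| = 1 -> 0 <= t ->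
  (t%:E < local_reach A (x, n))%E -> unique_nearest A (x + t * n) x.
Proof.
move=> n1 t0 /lt_local_reachP[s [ts s0]].
by apply: unique_nearest_closer => //; rewrite t0 ltW.
Qed.

(** The reach at the end of a gap is half the gap length: the first competitor of [x] is the
    opposite end [q], at equal distance from the midpoint. *)
Lemma lt_reach_right A x q t : gap_ends A x q -> 0 <= t ->
  (t%:E < local_reach A (x, 1%R))%E <-> 2 * t < q - x.
Proof.
move=> [Ax Aq xq xqA] t0; rewrite lt_local_reachP; split=> [[s [ts s0 [_ xs]]]|tq].
  have : `|x + s * 1 - x| < `|x + s * 1 - q| by apply: xs => //; rewrite gt_eqF.
  have -> : x + s * 1 - x = s by ring.
  rewrite mulr1 ger0_norm // => sq.
  by case: (ger0P (x + s - q)) sq => ? ?; lra.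
(* A height strictly between [t] and half the gap length. *)
exists ((t + (q - x) / 2) / 2); split; [lra|lra|split=> // a Aa ax].
set s := (t + _) / 2; have sx : 0 <= s < (q - x) / 2 by rewrite /s; lra.
have -> : x + s * 1 - x = s by ring.
rewrite mulr1 ger0_norm; last by case/andP: sx.
have [xa|ax'] := ltP x a; last first.
  have {}ax' : a < x by rewrite lt_neqAle ax.
  by rewrite ger0_norm; lra.
have qa : q <= a by rewrite leNgt; apply/negP => aq; case: (xqA a) => //; apply/andP.
by rewrite ler0_norm; lra.
Qed.

Lemma lt_reach_left A p x t : gap_ends A p x -> 0 <= t ->
  (t%:E < local_reach A (x, (-1)%R))%E <-> 2 * t < x - p.
Proof.
move=> [Ap Ax px pxA] t0; rewrite lt_local_reachP; split=> [[s [ts s0 [_ xs]]]|tq].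
  have : `|x + s * -1 - x| < `|x + s * -1 - p| by apply: xs => //; rewrite lt_eqF.
  have -> : x + s * -1 - x = - s by ring.
  rewrite normrN mulrN1 ger0_norm // => sp.
  by case: (ger0P (x - s - p)) sp => ? ?; lra.
exists ((t + (x - p) / 2) / 2); split; [lra|lra|split=> // a Aa ax].
set s := (t + _) / 2; have sx : 0 <= s < (x - p) / 2 by rewrite /s; lra.
have -> : x + s * -1 - x = - s by ring.
rewrite normrN mulrN1 ger0_norm; last by case/andP: sx.
have [xa|ax'] := ltP x a; first by rewrite ler0_norm; lra.
have {}ax' : a < x by rewrite lt_neqAle ax.
have qa : a <= p by rewrite leNgt; apply/negP => aq; case: (pxA a) => //; apply/andP.
by rewrite ger0_norm; lra.
Qed.

(** The outer normals have infinite reach, so any height above [t] is a witness. *)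
Lemma lt_reach_max A x t : is_max_of A x -> 0 <= t ->
  (t%:E < local_reach A (x, 1%R))%E.
Proof.
move=> [Ax xA] t0; apply/lt_local_reachP; exists (t + 1); split; [lra|lra|].
split=> // a Aa ax; have {}ax : a < x by rewrite lt_neqAle ax xA.
by rewrite mulr1 !ger0_norm; lra.
Qed.

Lemma lt_reach_min A x t : is_min_of A x -> 0 <= t ->
  (t%:E < local_reach A (x, (-1)%R))%E.
Proof.
move=> [Ax xA] t0; apply/lt_local_reachP; exists (t + 1); split; [lra|lra|].
split=> // a Aa ax; have {}ax : x < a by rewrite lt_neqAle eq_sym ax xA.
by rewrite mulrN1 !ler0_norm; lra.
Qed.

(** Its cardinality is twice the basic function at [t], and it is also the slope of the tube
    function just to the right of [t]. *)
Definition far_normals A t : set (R * R) :=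
  normal_bundle A `&` [set p | (t%:E < local_reach A p)%E].

Lemma far_normals_right A x t : A !=set0 -> compact A -> 0 <= t ->
  far_normals A t (x, 1) <->
  is_max_of A x \/ exists2 q, gap_ends A x q & 2 * t < q - x.
Proof.
move=> A0 cA t0; rewrite /far_normals /setI /= normal_bundle_right //; split.
  case=> -[_ [|[q xq]]]; first by left.
  by move=> /(lt_reach_right xq t0); right; exists q.
case=> [maxx|[q xq tq]].
  by split; [split; [case: maxx|left]|exact: lt_reach_max].
split; last exact/(lt_reach_right xq t0).
by split; [case: xq|right; exists q].
Qed.

Lemma far_normals_left A x t : A !=set0 -> compact A -> 0 <= t ->
  far_normals A t (x, -1) <->
  is_min_of A x \/ exists2 p, gap_ends A p x & 2 * t < x - p.
Proof.
move=> A0 cA t0; rewrite /far_normals /setI /= normal_bundle_left //; split.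
  case=> -[_ [|[q xq]]]; first by left.
  by move=> /(lt_reach_left xq t0); right; exists q.
case=> [maxx|[q xq tq]].
  by split; [split; [case: maxx|left]|exact: lt_reach_min].
split; last exact/(lt_reach_left xq t0).
by split; [case: xq|right; exists q].
Qed.

(* The normals are enumerated by alternating the two directions; in each of
   them index 0 is the unbounded component and index [j.+1] the gap [j]. *)
Lemma far_normals_bij A l t n : A !=set0 -> compact A -> is_fractal_string A l ->
  0 < t -> [set j | 2 * t < l j] = `I_n ->
  exists h : nat -> R * R, set_bij `I_(n.+1).*2 (far_normals A t) h.
Proof.
move=> A0 cA /(fractal_string_ends A0 cA)[lo [hi [lohi llen lohi_surj loI hiI]]] t0 nE.
have [p minp] := compact_is_min A0 cA; have [q maxq] := compact_is_max A0 cA.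
have tn j : (2 * t < l j) = (j < n)%N.
  by have := congr1 (@^~ j) nE; rewrite /= => e; apply/idP/idP; rewrite e.
have tj j : (j < n)%N -> terms l j by rewrite -tn /terms /=; lra.
pose r k := if k is j.+1 then lo j else q.
pose s k := if k is j.+1 then hi j else p.
(* Index 0 carries the maximum [q], which no left end of a gap can equal since [lo k < hi k <= q].
   The case of [s] is symmetric, with the minimum [p]. *)
have rI i j : (i <= n)%N -> (j <= n)%N -> r i = r j -> i = j.
  have lo_lt k : (k < n)%N -> lo k < q.
    by move=> /tj/lohi[_ Ah lh _]; apply: lt_le_trans lh _; exact: (proj2 maxq).
  case: i j => [|i] [|j] //= iN jN e.
  - by have := lo_lt _ jN; rewrite -e ltxx.
  - by have := lo_lt _ iN; rewrite e ltxx.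
  - by congr S; apply: loI => //; apply/mem_set; exact: tj.
have sI i j : (i <= n)%N -> (j <= n)%N -> s i = s j -> i = j.
  have hi_lt k : (k < n)%N -> p < hi k.
    by move=> /tj/lohi[Al _ lh _]; apply: le_lt_trans lh; exact: (proj2 minp).
  case: i j => [|i] [|j] //= iN jN e.
  - by have := hi_lt _ jN; rewrite -e ltxx.
  - by have := hi_lt _ iN; rewrite e ltxx.
  - by congr S; apply: hiI => //; apply/mem_set; exact: tj.
pose h k : R * R := if odd k then (s k./2, -1) else (r k./2, 1).
have hN k : (k < n.+1.*2)%N -> (k./2 <= n)%N by rewrite -ltn_half_double.
have far_r k : (k <= n)%N -> far_normals A t (r k, 1).
  move=> kn; apply/far_normals_right => //; first exact: ltW.
  case: k kn => [|j] jn /=; [by left|right; exists (hi j); first exact/lohi/tj].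
  by rewrite -llen ?tn //; exact: tj.
have far_s k : (k <= n)%N -> far_normals A t (s k, -1).
  move=> kn; apply/far_normals_left => //; first exact: ltW.
  case: k kn => [|j] jn /=; [by left|right; exists (lo j); first exact/lohi/tj].
  by rewrite -llen ?tn //; exact: tj.
exists h; split.
- by move=> k /= /hN kn; rewrite /h; case: ifP => _; [exact: far_s|exact: far_r].
- move=> i j /set_mem /hN iN /set_mem /hN jN.
  rewrite /h; move: (odd_double_half i) (odd_double_half j).
  (* Indices of different parity carry opposite directions, which is absurd; for equal parity the
     feet coincide, so the halves of the indices do. *)
  case: (odd i) (odd j) => -[] ei ej e; have /= := congr1 snd e => e2;
    try (by exfalso; move: e2; clear; lra); have /= e1 := congr1 fst e.
    by rewrite -ei -ej (sI _ _ iN jN e1).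
  by rewrite -ei -ej (rI _ _ iN jN e1).
- move=> [x m] /[dup] far [[_ /= m1 _] _].
  case: m1 far => -> far.
  + case/(far_normals_right x A0 cA (ltW t0)): far => [maxx|[y xy ty]].
      exists 0%N => //; congr pair; apply/eqP; rewrite eq_le.
      by rewrite (proj2 maxx) ?(proj2 maxq) //; [case: maxx|case: maxq].
    have [j [jl jx jy]] := lohi_surj _ _ xy.
    have jn : (j < n)%N by rewrite -tn llen // jx jy.
    exists (j.+1.*2); first by rewrite /= ltn_double ltnS.
    by rewrite /h odd_double doubleK /= jx.
  + case/(far_normals_left x A0 cA (ltW t0)): far => [minx|[y xy ty]].
      exists 1%N => //; congr pair; apply/eqP; rewrite eq_le.
      by rewrite (proj2 minx) ?(proj2 minp) //; [case: minx|case: minp].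
    have [j [jl jx jy]] := lohi_surj _ _ xy.
    have jn : (j < n)%N by rewrite -tn llen // jx jy.
    exists (j.+1.*2.+1); first by rewrite /= ltn_Sdouble ltnS.
    by rewrite /h /= odd_double uphalf_double /= jy.
Qed.

End Reach.

(** * Volume gained by the parallel set between two radii *)

Section TubeIncrement.
Context {R : realType}.
Implicit Types (A C : set R) (x y z q a s t e : R) (p : R * R) (l : nat -> R).

Lemma dist_to_attained A z : A !=set0 -> compact A ->
  exists a, [/\ A a, dist_to A z = `|z - a| &
                forall b, A b -> dist_to A z <= `|z - b|].
Proof.
move=> A0 cA; have [|a /set_mem Aa aA] :=
    @compact_EVT_min _ R (fun a => `|z - a|) A A0 cA.
  apply: continuous_subspaceT => a.
  by apply: cvg_norm; apply: cvgB; [exact: cvg_cst|exact: cvg_id].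
have lb : lbound [set `|z - a| | a in A] `|z - a|.
  by move=> _ [b Ab <-]; apply: aA; exact/mem_set.
have dE : dist_to A z = `|z - a|.
  apply/eqP; rewrite eq_le; apply/andP; split.
    by apply: ge_inf; [exists `|z - a| | exists a].
  by apply: lb_le_inf => //; exists `|z - a|; exists a.
by exists a; split=> // b Ab; rewrite dE; apply: lb; exists b.
Qed.

Lemma parallel_setP A e z : A !=set0 -> compact A ->
  parallel_set A e z <-> exists2 a, A a & `|z - a| <= e.
Proof.
move=> A0 cA; have [a [Aa zE dle]] := dist_to_attained z A0 cA.
rewrite /parallel_set /=; split=> [|[b /dle]]; last exact: le_trans.
by rewrite zE; exists a.
Qed.

(** The parallel set is the image of the compact product of [A] and a segment under addition.
    Compactness supplies its measurability and finite measure. *)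
Lemma parallel_set_compact A e : A !=set0 -> compact A ->
  compact (parallel_set A e).
Proof.
move=> A0 cA.
suff -> : parallel_set A e =
    (fun p : R * R => p.1 + p.2) @` (A `*` `[- e, e]%classic).
  apply: continuous_compact; last exact: compact_setX cA (@segment_compact _ _ _).
  apply: continuous_subspaceT => p.
  by apply: cvgD; [exact: cvg_fst|exact: cvg_snd].
apply/seteqP; split=> [z /(parallel_setP _ _ A0 cA)[a Aa za]|_ [[a s] /= [Aa se] <-]].
  exists (a, z - a) => /=; last by rewrite addrC subrK.
  by split=> //; rewrite in_itv /= -ler_norml.
apply/parallel_setP => //; exists a => //.
by rewrite addrC addKr ler_norml; rewrite in_itv in se.
Qed.

Lemma compact_measurable A : compact A -> measurable A.
Proof.
by move=> cA; apply: measurable_realfun.closed_measurable; apply: compact_closed => //; exact: Rhausdorff.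
Qed.

(** For [z] to the right of its nearest point [a], the open interval from [a] to its mirror image
    [2 * z - a] misses [A]. So [a] is the maximum, or it starts a gap of length at least
    [2 * (z - a)], which exceeds [2 * x]. *)
Lemma far_normals_nearest A x z a : A !=set0 -> compact A ->
  0 <= x -> A a -> (forall b, A b -> `|z - a| <= `|z - b|) -> x < `|z - a| ->
  far_normals A x (a, Num.sg (z - a)).
Proof.
move=> A0 cA x0 Aa aA xza; have [za|az] := ltP a z.
  rewrite gtr0_sg ?subr_gt0 //; rewrite ger0_norm in xza aA; last lra.
  apply/far_normals_right => //; have [q maxq] := compact_is_max A0 cA.
  have [aq|qa] := ltP a q; last first.
    by left; split=> // b /(proj2 maxq) bq; exact: le_trans bq qa.
  have far b : A b -> b <= a \/ 2 * z - a <= b.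
    by move=> /aA; case: (ger0P (z - b)) => ? ?; [left|right]; lra.
  (* The midpoint of [a] and [z] is off [A]; the gap around it must begin at [a] and end beyond the
     mirror image. *)
  have [|||p [r [pr /andP[pm mr]]]] := @gap_ends_around _ A ((a + z) / 2) cA.
  - by move=> /far; lra.
  - by exists a => //; lra.
  - by exists q; [case: maxq|case: (far q (proj1 maxq)); lra].
  - right; exists r; last by case: pr => _ Ar _ _; case: (far r Ar); lra.
    suff -> : a = p by [].
    case: (pr) => Ap _ _ prA; case: (far p Ap); last lra.
    move=> pa; apply/eqP; rewrite eq_le pa andbT leNgt; apply/negP => pa'.
    by apply: (prA a) => //; lra.
have {}az : z < a.
  by rewrite lt_neqAle az andbT; apply/eqP => e; move: xza; rewrite e subrr normr0; lra.
rewrite ltr0_sg ?subr_lt0 //; rewrite ltr0_norm ?subr_lt0 // in xza aA.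
apply/far_normals_left => //; have [q minq] := compact_is_min A0 cA.
have [qa|aq] := ltP q a; last first.
  by left; split=> // b /(proj2 minq) bq; exact: le_trans aq bq.
have far b : A b -> a <= b \/ b <= 2 * z - a.
  by move=> /aA; case: (ger0P (z - b)) => ? ?; [right|left]; lra.
have [|||p [r [pr /andP[pm mr]]]] := @gap_ends_around _ A ((a + z) / 2) cA.
- by move=> /far; lra.
- by exists q; [case: minq|case: (far q (proj1 minq)); lra].
- by exists a => //; lra.
- right; exists p; last by case: pr => Ap _ _ _; case: (far p Ap); lra.
  suff -> : a = r by [].
  case: (pr) => _ Ar _ prA; case: (far r Ar); last lra.
  move=> ra; apply/eqP; rewrite eq_le ra /= leNgt; apply/negP => ra'.
  by apply: (prA a) => //; lra.
Qed.

(** Finite reaches are half gap lengths. With no length strictly between [2 * x] and [2 * y], a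
    reach above [x] is at least [y], hence above [s]. *)
Lemma far_normals_sub A l x y s : A !=set0 -> compact A -> is_fractal_string A l ->
  (forall j, ~ (2 * x < l j < 2 * y)) -> 0 <= x <= s -> s < y ->
  far_normals A x `<=` far_normals A s.
Proof.
move=> A0 cA /(fractal_string_ends A0 cA)[lo [hi [_ llen lohi_surj _ _]]] gapl.
move=> /andP[x0 xs] sy; have s0 : 0 <= s by exact: le_trans xs.
have long a b : gap_ends A a b -> 2 * x < b - a -> 2 * s < b - a.
  move=> /lohi_surj[j [lj <- <-]]; rewrite -llen // => xl.
  by rewrite ltNge; apply/negP => ls; apply: (gapl j); lra.
move=> [a n] Mx; have [[_ /= n1 _] _] := Mx; case: n1 Mx => -> Mx.
  apply/far_normals_right => //; have [|[b ab xab]] := (far_normals_right a A0 cA x0).1 Mx.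
    by left.
  by right; exists b; rewrite ?(long a b).
apply/far_normals_left => //; have [|[b ba xba]] := (far_normals_left a A0 cA x0).1 Mx.
  by left.
by right; exists b; rewrite ?(long b a).
Qed.

Lemma far_normals_unit A t p : far_normals A t p -> p.2 = 1 \/ p.2 = -1.
Proof. by case=> -[]. Qed.

(** As [p.2] will be 1 or -1, the product is the signed height of [z] above the foot [p.1] along the
    normal. *)
Definition open_piece x y p : set R := [set z | x < (z - p.1) * p.2 < y].
Definition closed_piece x y p : set R := [set z | x <= (z - p.1) * p.2 <= y].

Lemma open_pieceE x y p : p.2 = 1 \/ p.2 = -1 -> exists a b,
  b - a = y - x /\ open_piece x y p = `]a, b[%classic.
Proof.
rewrite /open_piece => -[] ->; [exists (p.1 + x), (p.1 + y)|exists (p.1 - y), (p.1 - x)];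
  (split; first lra); apply/seteqP; split=> z /=; rewrite in_itv /=; lra.
Qed.

Lemma closed_pieceE x y p : p.2 = 1 \/ p.2 = -1 -> exists a b,
  b - a = y - x /\ closed_piece x y p = `[a, b]%classic.
Proof.
rewrite /closed_piece => -[] ->; [exists (p.1 + x), (p.1 + y)|exists (p.1 - y), (p.1 - x)];
  (split; first lra); apply/seteqP; split=> z /=; rewrite in_itv /=; lra.
Qed.

Lemma lebesgue_measure_bounded_itv (b1 b2 : bool) (a b : R) : a <= b ->
  lebesgue_measure [set` Interval (BSide b1 a) (BSide b2 b)] = (b - a)%:E.
Proof.
move=> ab; rewrite lebesgue_measure_itv /= lte_fin; case: ltP => [_|ba].
  by rewrite EFinB.
by rewrite (le_anti (introT andP (conj ab ba))) subrr.
Qed.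

Lemma measure_open_piece x y p : p.2 = 1 \/ p.2 = -1 -> x <= y ->
  measurable (open_piece x y p) /\
  lebesgue_measure (open_piece x y p) = (y - x)%:E.
Proof.
move=> /(open_pieceE x y)[a [b [ab ->]]] xy; split; first exact: measurable_itv.
by rewrite lebesgue_measure_bounded_itv ?ab //; lra.
Qed.

Lemma measure_closed_piece x y p : p.2 = 1 \/ p.2 = -1 -> x <= y ->
  measurable (closed_piece x y p) /\
  lebesgue_measure (closed_piece x y p) = (y - x)%:E.
Proof.
move=> /(closed_pieceE x y)[a [b [ab ->]]] xy; split; first exact: measurable_itv.
by rewrite lebesgue_measure_bounded_itv ?ab //; lra.
Qed.

Lemma normal_param z p s : p.2 = 1 \/ p.2 = -1 -> s = (z - p.1) * p.2 ->
  z = p.1 + s * p.2.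
Proof. by move=> [] -> ->; ring. Qed.

(** The reach at [p] exceeds not only [x] but also the height [s] of [z], by [far_normals_sub]; so
    [p.1] is still the unique nearest point at that height. *)
Lemma open_piece_nearest A l x y z p : A !=set0 -> compact A ->
  is_fractal_string A l -> (forall j, ~ (2 * x < l j < 2 * y)) -> 0 < x ->
  far_normals A x p -> open_piece x y p z ->
  [/\ x < `|z - p.1|, `|z - p.1| < y & unique_nearest A z p.1].
Proof.
move=> A0 cA lA gapl x0 Mp /andP[]; set s := (z - p.1) * p.2 => xs sy.
have p2 := far_normals_unit Mp.
have zE : z = p.1 + s * p.2 by exact: normal_param.
have n1 : `|p.2| = 1 by case: p2 => ->; rewrite ?normrN normr1.
have ds : `|z - p.1| = s.
  by rewrite {1}zE addrC addKr normrM n1 mulr1 gtr0_norm //; exact: lt_trans xs.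
rewrite ds; split=> //; rewrite zE.
have [] // := far_normals_sub A0 cA lA gapl _ sy Mp; first by rewrite !ltW.
move=> _ /=; case: (p) n1 => a n /= n1; apply: unique_nearest_lt_reach => //.
by apply: ltW; exact: lt_trans xs.
Qed.

(** A common point of two pieces has only one nearest point, so the feet agree. With a common foot,
    opposite directions would give heights of opposite sign, whereas both exceed [x > 0]. *)
Lemma trivIset_open_pieces A l x y : A !=set0 -> compact A ->
  is_fractal_string A l -> (forall j, ~ (2 * x < l j < 2 * y)) -> 0 < x ->
  trivIset (far_normals A x) (open_piece x y).
Proof.
move=> A0 cA lA gapl x0 p q Mp Mq [z [zp zq]].
have [_ _ [Ap pA]] := open_piece_nearest A0 cA lA gapl x0 Mp zp.
have [_ _ [Aq qA]] := open_piece_nearest A0 cA lA gapl x0 Mq zq.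
have pq1 : p.1 = q.1.
  apply/eqP; apply: contrapT => /negP pq.
  by have := pA _ Aq; rewrite eq_sym => /(_ pq); have := qA _ Ap pq; lra.
suff pq2 : p.2 = q.2 by case: p q pq1 pq2 {Mp Mq zp zq Ap pA Aq qA} => [? ?] [? ?] /= -> ->.
move: zp zq; rewrite /open_piece /= pq1.
by case: (far_normals_unit Mp) (far_normals_unit Mq) => -> [] ->; lra.
Qed.

Lemma fsum_const_bij (I : choiceType) (D : set I) (h : nat -> I) n (c : R) :
  set_bij `I_n D h -> (\sum_(i \in D) c%:E = (n%:R * c)%:E)%E.
Proof.
move=> hD; rewrite (reindex_fsbig h _ _ _ hD) -fsbig_ord sumEFin sumr_const card_ord.
by rewrite mulr_natl.
Qed.

Lemma measure_tube_increment A l x y n : A !=set0 -> compact A ->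
  is_fractal_string A l -> (forall j, ~ (2 * x < l j < 2 * y)) -> 0 < x -> x <= y ->
  [set j | 2 * x < l j] = `I_n ->
  lebesgue_measure (parallel_set A y `\` parallel_set A x) =
    (n.+1.*2%:R * (y - x))%:E.
Proof.
move=> A0 cA lA gapl x0 xy nE.
have [h hM] := far_normals_bij A0 cA lA x0 nE.
have finM : finite_set (far_normals A x).
  by apply: sub_finite_set (set_bij_surj hM) _; exact/finite_image/finite_II.
have unitM p : far_normals A x p -> p.2 = 1 \/ p.2 = -1 by exact: far_normals_unit.
have mO p : far_normals A x p -> measurable (open_piece x y p).
  by move=> /unitM p2; case: (measure_open_piece p2 xy).
have mC p : far_normals A x p -> measurable (closed_piece x y p).
  by move=> /unitM p2; case: (measure_closed_piece p2 xy).
have mS : measurable (parallel_set A y `\` parallel_set A x).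
  by apply: measurableD; apply: compact_measurable; exact: parallel_set_compact.
(* The claimed value is written as a sum over the normals, once with closed pieces for the upper
   bound and once with open pieces for the lower bound. *)
have sumE (F : R * R -> set R) :
    (forall p, p.2 = 1 \/ p.2 = -1 -> lebesgue_measure (F p) = (y - x)%:E) ->
    (n.+1.*2%:R * (y - x))%:E = (\sum_(p \in far_normals A x) lebesgue_measure (F p))%E.
  move=> FE; rewrite -(fsum_const_bij (y - x) hM).
  by apply: eq_fsbigr => p /set_mem/unitM/FE.
apply/eqP; rewrite eq_le; apply/andP; split.
  (* Covering: a point of the layer lies on the normal issued from its nearest point [a], at height
     equal to its distance to [A]. *)
  rewrite (sumE (closed_piece x y)); last by move=> p p2; case: (measure_closed_piece p2 xy).
  apply: content_sub_fsum => // z [/= zy zx].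
  have [a [Aa zE az]] := dist_to_attained z A0 cA.
  have xza : x < `|z - a| by rewrite -zE ltNge; exact/negP.
  exists (a, Num.sg (z - a)).
    by apply: far_normals_nearest => //; [exact: ltW|move=> b /az; rewrite zE].
  by rewrite /closed_piece /= mulrC -normrEsg ltW //= -zE.
(* Packing: the open pieces are disjoint and contained in the layer. *)
rewrite (sumE (open_piece x y)); last by move=> p p2; case: (measure_open_piece p2 xy).
rewrite -measure_fin_bigcup //; last exact: trivIset_open_pieces lA gapl x0.
apply: le_measure; rewrite ?inE //; first exact: fin_bigcup_measurable.
move=> z [p Mp zp].
have [xz zy [Ap pA]] := open_piece_nearest A0 cA lA gapl x0 Mp zp.
split; first by apply/parallel_setP => //; exists p.1 => //; exact: ltW.
move=> /(parallel_setP _ _ A0 cA)[a Aa]; have [->|ap] := eqVneq a p.1; first lra.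
by have := pA _ Aa ap; lra.
Qed.

(** The tube of radius [y] is the disjoint union of the tube of radius [x] and the layer between the
    radii. Finiteness of both measures lets [fine] respect the sum. *)
Lemma tube_increment A l x y n : A !=set0 -> compact A ->
  is_fractal_string A l -> (forall j, ~ (2 * x < l j < 2 * y)) -> 0 < x -> x <= y ->
  [set j | 2 * x < l j] = `I_n ->
  tube_function A y = tube_function A x + n.+1.*2%:R * (y - x).
Proof.
move=> A0 cA lA gapl x0 xy nE.
have mA := compact_measurable cA.
have mP e : measurable (parallel_set A e).
  by apply: compact_measurable; exact: parallel_set_compact.
have Asub : A `<=` parallel_set A x.
  by move=> a Aa; apply/parallel_setP => //; exists a; rewrite // subrr normr0 ltW.
have sub : parallel_set A x `<=` parallel_set A y.
  by move=> z /= zx; exact: le_trans xy.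
have finP : (lebesgue_measure (parallel_set A x `\` A) < +oo)%E.
  have finP : (lebesgue_measure (parallel_set A x) < +oo)%E.
    by apply: compact_finite_measure; exact: parallel_set_compact.
  apply: le_lt_trans finP.
  by apply: le_measure; rewrite ?inE; [apply: measurableD; [exact: mP|exact: mA]|exact: mP|exact: subDsetl].
have -> : tube_function A y =
    fine (lebesgue_measure (parallel_set A x `\` A) + (n.+1.*2%:R * (y - x))%:E)%E.
  rewrite -(measure_tube_increment A0 cA lA gapl x0 xy nE) -measureU.
  - congr (fine (lebesgue_measure _)); apply/seteqP; split=> z.
      by move=> [zy zA]; have [zx|zx] := pselect (parallel_set A x z); [left|right].
    by move=> [[/sub ? ?]|[? zx]]; split=> // /Asub.
  - by apply: measurableD; [exact: mP|exact: mA].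
  - by apply: measurableD; exact: mP.
  - by apply/seteqP; split=> // z [[? _] [_]].
by rewrite fineD // ge0_fin_numE.
Qed.

End TubeIncrement.

(** * Counting long gaps, and the values of the two counting expressions *)

Section Counts.
Context {R : realType}.
Implicit Types (A : set R) (l : nat -> R) (t e : R).

(** The bound is the least index at which [P] fails. *)
Lemma initial_segment (P : pred nat) :
  (forall i j, (i <= j)%N -> P j -> P i) -> (exists N, ~~ P N) ->
  exists n, [set j | P j] = `I_n.
Proof.
move=> Pdec exN; have nP := ex_minnP exN; case: nP => n Pn nmin.
exists n; apply/seteqP; split=> j /= Pj.
  by rewrite ltnNge; apply: contra Pn => nj; exact: Pdec Pj.
by apply/negPn/negP => /nmin; rewrite leqNgt Pj.
Qed.

(** Otherwise every index would be an actual term, giving arbitrarily many disjoint gaps of length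
    at least [t] between the minimum and the maximum of [A]. *)
Lemma fractal_string_small A l t : A !=set0 -> compact A ->
  is_fractal_string A l -> 0 < t -> exists N, l N < t.
Proof.
move=> A0 cA lA t0; apply: contrapT => noN.
have tl j : t <= l j by rewrite leNgt; apply/negP => lt; apply: noN; exists j.
have tj j : terms l j by exact: lt_le_trans (tl j).
have [lo [hi [lohi llen _ loI _]]] := fractal_string_ends A0 cA lA.
have [p [_ minp]] := compact_is_min A0 cA; have [q [Aq maxq]] := compact_is_max A0 cA.
pose g j : set R := `]lo j, hi j[%classic.
have gdisj D : trivIset D g.
  move=> i j _ _ [z []]; rewrite /g /= !in_itv /= => zi zj.
  apply: loI; [exact/mem_set|exact/mem_set|].
  have [Ai _ _ iA] := lohi i (tj i); have [Aj _ _ jA] := lohi j (tj j).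
  (* Of two intersecting gaps with different left ends, one would contain the larger left end, a
     point of [A]. *)
  apply/eqP; rewrite eq_le !leNgt; apply/andP; split; apply/negP => ij.
    by apply: (jA (lo i)) => //; lra.
  by apply: (iA (lo j)) => //; lra.
have bound N : N%:R * t <= q - p.
  have le1 : ((N%:R * t)%:E <= \sum_(j \in `I_N) lebesgue_measure (g j))%E.
    rewrite -fsbig_ord mulr_natl -[in X in (X <= _)%E](card_ord N) -sumr_const -sumEFin.
    apply: lee_sum => j _; have [_ _ lh _] := lohi j (tj j).
    by rewrite (lebesgue_measure_bounded_itv _ _ (ltW lh)) lee_fin -llen.
  rewrite -lee_fin; apply: le_trans le1 _.
  have mg j : measurable (g j) by exact: measurable_itv.
  rewrite -measure_fin_bigcup; [|exact: finite_II|exact: gdisj|by move=> j _; exact: mg].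
  rewrite -(lebesgue_measure_bounded_itv true false (minp _ Aq)).
  apply: le_measure; rewrite ?inE.
  - by apply: fin_bigcup_measurable => [|j _]; [exact: finite_II|exact: mg].
  - exact: measurable_itv.
  move=> z [j _]; rewrite /g /= !in_itv /= => zj.
  have [/minp pl /maxq hq _ _] := lohi j (tj j); lra.
have := bound (Num.truncn ((q - p) / t)).+1.
by rewrite leNgt -ltr_pdivrMr // truncnS_gt.
Qed.

(** Monotonicity makes these index sets initial segments. The strict count governs the reaches and
    right derivatives, the non-strict one the geometric counting function and left derivatives. *)
Lemma long_lengths_initial A l t : A !=set0 -> compact A ->
  is_fractal_string A l -> 0 < t ->
  (exists n, [set j | t < l j] = `I_n) /\ (exists k, [set j | t <= l j] = `I_k).
Proof.
move=> A0 cA lA t0; have [N lN] := fractal_string_small A0 cA lA t0.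
have [_ lmono _] := lA.
split; apply: initial_segment.
- by move=> i j ij tj; apply: lt_le_trans tj (lmono _ _ ij).
- by exists N; rewrite -leNgt ltW.
- by move=> i j ij tj; apply: le_trans tj (lmono _ _ ij).
- by exists N; rewrite -ltNge.
Qed.

Lemma counting_bij (T : choiceType) (D : set T) n (h : nat -> T) :
  set_bij `I_n D h -> counting D = n%:R%:E :> \bar R.
Proof.
move=> hD; have DI : (D #= `I_n)%card.
  have -> : D = h @` `I_n.
    by apply/seteqP; split; [exact: set_bij_surj|exact: set_bij_sub].
  by apply: inj_card_eq; exact: set_bij_inj hD.
rewrite /counting asboolT; first by rewrite (card_fset_set DI).
by apply/finite_setP; exists n.
Qed.

Lemma counting_II n : counting `I_n = n%:R%:E :> \bar R.
Proof. by apply: (@counting_bij _ _ n id); split=> // j; exists j. Qed.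

(** Inversion reverses the inequality between positive numbers. The zeros continuing a finite string
    are dropped on one side by [terms] and on the other because [2 * e] is positive. *)
Lemma geometric_countingE l e k : 0 < e -> [set j | 2 * e <= l j] = `I_k ->
  geometric_counting l (1 / (2 * e)) = k%:R%:E.
Proof.
move=> e0 kE; rewrite /geometric_counting -counting_II -kE; congr counting.
apply/seteqP; split=> j /=.
  by move=> [lj]; rewrite div1r lef_pV2 // posrE ?mulr_gt0.
move=> elj; have lj : 0 < l j by apply: lt_le_trans elj; rewrite mulr_gt0.
by split=> //; rewrite div1r lef_pV2 // posrE ?mulr_gt0.
Qed.

(** The integral over the normal bundle is the half-counting measure of [far_normals A t], and the
    factor 2 cancels the half. *)
Lemma basic_functionE A l t n : A !=set0 -> compact A -> is_fractal_string A l ->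
  0 < t -> [set j | 2 * t < l j] = `I_n ->
  (2%:E * basic_function A t = n.+1.*2%:R%:E)%E.
Proof.
move=> A0 cA lA t0 nE; have [h hM] := far_normals_bij A0 cA lA t0 nE.
have finM : finite_set (far_normals A t).
  by apply: sub_finite_set (set_bij_surj hM) _; exact/finite_image/finite_II.
have mM : measurable (far_normals A t).
  (* A finite set is a finite union of points, and a point of the plane is a product of two
     measurable singletons. *)
  rewrite -(fsbig_setU_set1 finM) fsbig_setU //; apply: fin_bigcup_measurable => //.
  move=> [x y] _; rewrite (_ : [set _] = [set x] `*` [set y]).
    by apply: measurableX; exact: measurable_set1.
  by apply/seteqP; split=> [[a b] [-> ->]|[a b] /= [-> ->]].
rewrite /basic_function integral_mkcond.
rewrite (eq_integral (fun p => (\1_(far_normals A t) p)%:E)); last first.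
  move=> p _; rewrite patchE !indicE in_setI.
  by case: ifPn => // /negPf ->.
rewrite integral_indic // setIT /half_counting /= /mscale /= (counting_bij hM).
by rewrite -!EFinM mulrA divff ?mul1r.
Qed.

End Counts.

(** * Local affine form of the tube function and its derivatives *)

Section Derivatives.
Context {R : realType}.
Variables (A : set R) (l : nat -> R).
Hypotheses (A0 : A !=set0) (cA : compact A) (lA : is_fractal_string A l).
Implicit Types (e h x y : R).

Lemma half_lengths_mem j x : 0 < x -> l j = 2 * x -> half_lengths l x.
Proof. by move=> x0 lj; exists j; rewrite /terms /= lj ?mulr_gt0 //; field. Qed.

Lemma tube_affine_right e n : 0 < e -> [set j | 2 * e < l j] = `I_n ->
  exists2 d, 0 < d & forall h, 0 < h < d ->
    tube_function A (e + h) = tube_function A e + n.+1.*2%:R * h.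
Proof.
move=> e0 nE; have [_ lmono _] := lA.
have inI j : 2 * e < l j -> (j < n)%N.
  by move=> ej; rewrite -[is_true _]/(`I_n j) -nE.
have [d d0 dP] : exists2 d, 0 < d & forall h j, h < d -> ~ (2 * e < l j < 2 * (e + h)).
  (* The string is non-increasing, so the shortest length above [2 * e] is the one of index [n - 1],
     and staying below its half keeps the layer free of half lengths. When [n] is 0 any [d]
     works. *)
  case: n nE inI => [|m] nE inI.
    by exists 1 => // h j _ /andP[/inI].
  have em : 2 * e < l m by have := ltnSn m; rewrite -[is_true _]/(`I_m.+1 m) -nE.
  exists (l m / 2 - e); first lra.
  by move=> h j hd /andP[/inI jm]; have := lmono j m jm; lra.
exists d => // h /andP[h0 hd].
rewrite (tube_increment (x := e) (y := e + h) A0 cA lA _ e0 _ nE).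
- by ring.
- by move=> j; exact: dP.
- lra.
Qed.

(** Slightly below [e], the lengths exceeding [2 * (e - h)] are exactly those at least [2 * e]; this
    is why the left slope uses the non-strict count. *)
Lemma tube_affine_left e k : 0 < e -> [set j | 2 * e <= l j] = `I_k ->
  exists2 d, 0 < d & forall h, 0 < h < d ->
    tube_function A (e - h) = tube_function A e - k.+1.*2%:R * h.
Proof.
move=> e0 kE; have [_ lmono _] := lA.
have kI j : (2 * e <= l j) = (j < k)%N.
  by have := congr1 (@^~ j) kE; rewrite /= => ej; apply/idP/idP; rewrite ej.
have lk : l k < 2 * e by rewrite ltNge kI ltnn.
(* The first entry below [2 * e] is [l k], possibly 0; the bound [e] keeps the radius [e - h]
   positive. *)
exists (Num.min e (e - l k / 2)); first by rewrite lt_min e0 /=; lra.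
move=> h; rewrite lt_min => /and3P[h0 he hl].
have hI j : (2 * (e - h) < l j) = (j < k)%N.
  rewrite -kI; apply/idP/idP; last lra.
  move=> ej; rewrite kI ltnNge; apply/negP => kj; have := lmono k j kj; lra.
have kE' : [set j | 2 * (e - h) < l j] = `I_k.
  by apply/seteqP; split=> j /=; rewrite hI.
rewrite (tube_increment (x := e - h) (y := e) A0 cA lA _ _ _ kE').
- by ring.
- by move=> j; rewrite hI -kI; lra.
- lra.
- lra.
Qed.

Lemma tube_right_derivative e n : 0 < e -> [set j | 2 * e < l j] = `I_n ->
  difference_quotient (tube_function A) e h @[h --> 0^'+] --> (n.+1.*2%:R : R).
Proof.
move=> e0 nE; have [d d0 dP] := tube_affine_right e0 nE.
apply: cvg_near_cst; near=> h; have h0 : 0 < h by near: h; exact: nbhs_right_gt.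
rewrite /difference_quotient dP; last by rewrite h0 /=; near: h; exact: nbhs_right_lt.
by field; rewrite gt_eqF.
Unshelve. all: by end_near. Qed.

Lemma tube_left_derivative e k : 0 < e -> [set j | 2 * e <= l j] = `I_k ->
  difference_quotient (tube_function A) e h @[h --> 0^'-] --> (k.+1.*2%:R : R).
Proof.
move=> e0 kE; have [d d0 dP] := tube_affine_left e0 kE.
apply: cvg_near_cst; near=> h; have h0 : h < 0 by near: h; exact: nbhs_left_lt.
have hd : - d < h by near: h; apply: nbhs_left_gt; rewrite oppr_lt0.
(* The left affine formula is applied to the positive increment [- h]. *)
rewrite /difference_quotient -[in e + h](opprK h) dP; last by apply/andP; split; lra.
by field; rewrite lt_eqF.
Unshelve. all: by end_near. Qed.

(** When the strict and non-strict counts agree, the two one-sided formulas combine into a single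
    affine function near [e]. *)
Lemma tube_is_derive e n : 0 < e -> [set j | 2 * e < l j] = `I_n ->
  [set j | 2 * e <= l j] = `I_n ->
  is_derive e 1 (tube_function A) (n.+1.*2%:R : R).
Proof.
move=> e0 nE nE'; have [d d0 dP] := tube_affine_right e0 nE.
have [d' d'0 d'P] := tube_affine_left e0 nE'.
pose c : R := n.+1.*2%:R.
(* The affine function is built from [cst] and [id] so that its derivative is inferred from its
   shape. *)
have lin : is_derive e 1 (cst (tube_function A e - c * e) + c \*: id : R -> R) c.
  apply: is_derive_eq.
  by rewrite add0r; exact: mulr1.
apply: near_eq_is_derive lin.
near=> y.
transitivity (tube_function A e + c * (y - e)).
  by rewrite [LHS]/(tube_function A e - c * e + c * y) mulrBr addrA addrAC.
have ye : `|e - y| < Num.min d d'.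
  near: y; apply: (@nbhsx_ballx _ R e (Num.min d d')).
  by rewrite lt_min d0.
move: ye; rewrite lt_min !ltr_norml => /andP[yd yd'].
have [ey|ye|<-] := ltgtP e y; last by rewrite subrr mulr0 addr0.
- by rewrite -dP ?[e + _]addrC ?subrK //; lra.
- rewrite -[y in RHS](subKr e) d'P /c; last lra.
  by ring.
Unshelve. all: by end_near. Qed.

Lemma tube_piecewise_linear :
  piecewise_linear_pos (half_lengths l) (tube_function A).
Proof.
split=> [d d0|x [x0 xS]].
  have d20 : 0 < 2 * d by lra.
  have [_ [k kE]] := long_lengths_initial A0 cA lA d20.
  apply: (@sub_finite_set _ _ ((fun j => l j / 2) @` `I_k)).
    move=> _ [[j lj <-]]; rewrite /= in_itv /= andbT => dj.
    exists j => //; suff : `I_k j by []; rewrite -kE /=; lra.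
  exact/finite_image/finite_II.
have {}x0 : 0 < x by move: x0; rewrite /= in_itv /= andbT.
have x20 : 0 < 2 * x by lra.
have [[n nE] _] := long_lengths_initial A0 cA lA x20.
pose c : R := n.+1.*2%:R.
(* The slope is the count at [x], and the intercept makes the line pass through the value at [x]. *)
exists c, (tube_function A x - c * x) => y Cy.
set C := connected_component _ _ in Cy.
have Cx : C x.
  by apply: connected_component_refl; split=> //=; rewrite in_itv /= x0.
have itvC : is_interval C.
  exact/connected_intervalP/component_connected.
have CS z : C z -> 0 < z /\ ~ half_lengths l z.
  by move=> /connected_component_sub[]; rewrite /= in_itv /= andbT.
have y0 := (CS y Cy).1.
have [xy|yx] := leP x y.
  rewrite (tube_increment (x := x) (y := y) A0 cA lA _ x0 xy nE) -/c; first lra.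
  move=> j lj; have Cj : C (l j / 2) by apply: itvC Cx Cy _ _; lra.
  by apply: (CS _ Cj).2; apply: (@half_lengths_mem j); lra.
(* For [y < x] the increment starts at [y], so the count there must be compared with that at [x]: a
   half length between them would lie in the interval [C], which avoids them all. *)
have noj j : 2 * y < l j -> 2 * x < l j.
  move=> yj; rewrite ltNge; apply/negP => jx.
  have Cj : C (l j / 2) by apply: itvC Cy Cx _ _; lra.
  by apply: (CS _ Cj).2; apply: (@half_lengths_mem j); lra.
have nE' : [set j | 2 * y < l j] = `I_n.
  by rewrite -nE; apply/seteqP; split=> j /=; [exact: noj|lra].
rewrite (tube_increment (x := y) (y := x) A0 cA lA _ y0 (ltW yx) nE') -/c; first lra.
by move=> j /andP[/noj]; lra.
Qed.

Lemma not_half_length_segments e n : 0 < e -> ~ half_lengths l e ->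
  [set j | 2 * e < l j] = `I_n -> [set j | 2 * e <= l j] = `I_n.
Proof.
move=> e0 eS <-; apply/seteqP; split=> j /=; last exact: ltW.
rewrite le_eqVlt => /orP[/eqP ej|//].
by case: eS; exact: (@half_lengths_mem j).
Qed.

Lemma fractal_string_lengths :
  [set l j | j in terms l] = [set gap_length C | C in gaps A].
Proof.
have [_ _ [g gbij lg]] := lA; apply/seteqP; split=> [_ [j lj <-]|_ [C gC <-]].
  by exists (g j); [exact: set_bij_homo gbij _ lj|rewrite lg].
by have [j lj <-] := set_bij_surj gbij gC; exists j; rewrite ?lg.
Qed.

(** The lengths above [2 * e] take exactly the values [ld 0], ..., [ld m], so their indices split
    into the fibres of [l] over these values. Indexing from 0 makes this [m.+1] summands, and
    [ld m.+1] may be the filler 0. *)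
Lemma sum_multiplicities ld m e n : is_distinct_lengths A ld ->
  ld m.+1 / 2 < e < ld m / 2 -> [set j | 2 * e < l j] = `I_n ->
  ~ half_lengths l e /\ (\sum_(k < m.+1) multiplicity l (ld k) = n%:R%:E :> \bar R)%E.
Proof.
move=> [ld0 ldmono ldinj ldE] me nE.
have e0 : 0 < e by have := ld0 m.+1; lra.
have long i : 2 * e <= ld i -> (i <= m)%N.
  by move=> ei; rewrite leqNgt; apply/negP => mi; have := ldmono _ _ mi; lra.
have ldl j : terms l j -> exists2 i, terms ld i & ld i = l j.
  move=> lj; have : [set l j | j in terms l] (l j) by exists j.
  by rewrite fractal_string_lengths -ldE.
split.
  move=> [j /ldl[i _ ij] je]; have im : (i <= m)%N by apply: long; lra.
  by have := ldmono _ _ im; lra.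
rewrite -counting_II -nE (fsbig_ord _ _ (fun k => multiplicity l (ld k))).
rewrite (_ : [set j | 2 * e < l j] = \bigcup_(k in `I_m.+1) [set j | terms l j /\ l j = ld k]).
  (* Multiplicities are counting measures of disjoint fibres: [ld] is strictly decreasing on its
     actual terms, and indices up to [m] are such terms as [ld m] is positive. *)
  apply/esym/(measure_fin_bigcup (@counting nat R : {measure set nat -> \bar R})) => //.
  move=> i j /= im jm [s [[_ si] [_ sj]]].
  have pos k : (k < m.+1)%N -> terms ld k.
    by move=> km; have := ldmono _ _ (km : (k <= m)%N); rewrite /terms /=; lra.
  case: (ltngtP i j) => // ij.
    by have := ldinj _ _ ij (pos _ jm); rewrite -si -sj ltxx.
  by have := ldinj _ _ ij (pos _ im); rewrite -si -sj ltxx.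
apply/seteqP; split=> j /=.
  move=> ej; have lj : terms l j by rewrite /terms /=; lra.
  have [i _ il] := ldl j lj; exists i => //=.
  by rewrite ltnS; apply: long; lra.
by move=> [i /= im [lj ->]]; have := ldmono _ _ (im : (i <= m)%N); lra.
Qed.

End Derivatives.

Unset Implicit Arguments.

Theorem corollary8p3 (R : realType) (A : set R) (l : nat -> R)
  (A0 : A !=set0) (cA : compact A) (lA : is_fractal_string A l) :
  [/\ piecewise_linear_pos (half_lengths l) (tube_function A),
      forall eps : R, 0 < eps -> ~ half_lengths l eps ->
        [/\ derivable (tube_function A) eps 1,
            (derive1 (tube_function A) eps)%:E = (2%:E * basic_function A eps)%E &
            (2%:E * basic_function A eps =
              2%:E + 2%:E * geometric_counting l (1 / (2 * eps)))%E],
      forall eps : R, 0 < eps ->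
        [/\ right_derivable (tube_function A) eps,
            left_derivable (tube_function A) eps,
            (right_derivative (tube_function A) eps)%:E =
              (2%:E * basic_function A eps)%E &
            (left_derivative (tube_function A) eps)%:E =
              (2%:E + 2%:E * geometric_counting l (1 / (2 * eps)))%E] &
      forall ld : nat -> R, is_distinct_lengths A ld ->
        forall (m : nat) (eps : R), ld m.+1 / 2 < eps < ld m / 2 ->
          derivable (tube_function A) eps 1 /\
          (derive1 (tube_function A) eps)%:E =
            (2%:E + 2%:E * \sum_(k < m.+1) multiplicity l (ld k))%E].
Proof.
have slopeE k : (2%:E + 2%:E * k%:R%:E = k.+1.*2%:R%:E :> \bar R)%E.
  by rewrite -EFinM -EFinD -muln2 natrM -natr1; congr EFin; ring.
split=> [|e e0 eS|e e0|ld ldA m e me].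
- exact: tube_piecewise_linear.
- have e20 : 0 < 2 * e by lra.
  have [[n nE] _] := long_lengths_initial A0 cA lA e20.
  have nE' := not_half_length_segments e0 eS nE.
  have [de deE] := tube_is_derive A0 cA lA e0 nE nE'.
  split; first exact: de.
    by rewrite derive1E deE (basic_functionE A0 cA lA e0 nE).
  by rewrite (basic_functionE A0 cA lA e0 nE) (geometric_countingE e0 nE') slopeE.
- have e20 : 0 < 2 * e by lra.
  (* The counts [n] and [k] differ exactly when [e] is a half length; each one-sided derivative uses
     its own. *)
  have [[n nE] [k kE]] := long_lengths_initial A0 cA lA e20.
  have right := tube_right_derivative A0 cA lA e0 nE.
  have left := tube_left_derivative A0 cA lA e0 kE.
  split.
  + by apply/cvg_ex; eexists; exact: right.
  + by apply/cvg_ex; eexists; exact: left.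
  + by rewrite (basic_functionE A0 cA lA e0 nE) /right_derivative (cvg_lim _ right).
  + by rewrite (geometric_countingE e0 kE) slopeE /left_derivative (cvg_lim _ left).
- have e0 : 0 < e by have [ld0 _ _ _] := ldA; have := ld0 m.+1; lra.
  have e20 : 0 < 2 * e by lra.
  have [[n nE] _] := long_lengths_initial A0 cA lA e20.
  (* The location of [e] between consecutive distinct half lengths also yields that [e] is not a
     half length, so the two-sided derivative exists. *)
  have [eS ->] := sum_multiplicities lA ldA me nE.
  have nE' := not_half_length_segments e0 eS nE.
  have [de deE] := tube_is_derive A0 cA lA e0 nE nE'.
  by split; [exact: de|rewrite derive1E deE slopeE].
Qed.
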